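(* Let $k$ be an algebraically closed field. There are finite-dimensional $k$-algebras $\Lambda$ which are controlled wild and such that not every projective variety over $k$ can be realized as a quiver Grassmannian of a $\Lambda$-module; that is, there is a projective variety $V$ over $k$ which is not isomorphic to $\mathbb{G}_{\mathbf{e}}(M)$ for any finite-dimensional $\Lambda$-module $M$ and any dimension vector $\mathbf{e}$ for $\Lambda$.
   Context: Throughout, $k$ is an algebraically closed field, and modules over a finite-dimensional $k$-algebra are finite-dimensional left modules; $\operatorname{mod}\Lambda$ is the category of such $\Lambda$-modules. A projective variety over $k$ is a closed subset of some projective space $\mathbb{P}^n$ over $k$ (not required to be irreducible). Dimension vectors: a dimension vector for a finite-dimensional $k$-algebra $\Lambda$ is a function $\mathbf{d}$ from the set of isomorphism classes of simple $\Lambda$-modules to the non-negative integers. The dimension vector $\mathbf{dim}\, M$ of a $\Lambda$-module $M$ assigns to a simple module $S$ the Jordan–Hölder multiplicity $[M:S]$ of $S$ in $M$. Quiver Grassmannians: for a $\Lambda$-module $M$ and a dimension vector $\mathbf{e}$, $\mathbb{G}_{\mathbf{e}}(M)$ is the set of all submodules of $M$ with dimension vector $\mathbf{e}$. It is a projective variety, as a closed subset of the usual Grassmannian of subspaces of $M$ of dimension $\sum_S e_S\dim_k S$. Controlled wild: let $\operatorname{rad}$ be the radical of $\operatorname{mod}\Lambda$, i.e. the ideal of the category $\operatorname{mod}\Lambda$ generated by all non-invertible maps between indecomposable modules. For a collection $\mathcal{C}$ of objects of $\operatorname{mod}\Lambda$, let $\operatorname{add}\mathcal{C}$ be its closure under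 (finite) direct sums and direct summands, and let $\operatorname{Hom}(X,\mathcal{C},Y)\subseteq \operatorname{Hom}(X,Y)$ be the subgroup of all maps $X\to Y$ which factor through a module in $\operatorname{add}\mathcal{C}$. The algebra $\Lambda$ is called controlled wild if for any finite-dimensional $k$-algebra $\Gamma$ there is an exact embedding functor (a $k$-linear, exact, faithful functor) $F:\operatorname{mod}\Gamma\to\operatorname{mod}\Lambda$ and a full subcategory $\mathcal{C}$ of $\operatorname{mod}\Lambda$ such that for all $\Gamma$-modules $X,Y$, the subgroup $\operatorname{Hom}(FX,\mathcal{C},FY)$ is contained in $\operatorname{rad}(FX,FY)$ and $$\operatorname{Hom}(FX,FY)=F\operatorname{Hom}(X,Y)\oplus\operatorname{Hom}(FX,\mathcal{C},FY).$$ *)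

(* Defs.v *)
From HB Require Import structures.
From mathcomp Require Import all_boot all_order all_algebra all_field.
From mathcomp Require Import boolp mpoly.

Set Implicit Arguments.
Unset Strict Implicit.
Unset Printing Implicit Defensive.

Import GRing.Theory.
Local Open Scope ring_scope.

Section Modules.

Variables (k : fieldType) (A : falgType k).

Record fdmod := FdMod {
  carrier :> vectType k;
  act : {linear A -> 'End(carrier)};
  act1 : act 1 = \1%VF;
  actM : forall a b, act (a * b) = (act a \o act b)%VF }.

Definition modhom_pred (X Y : fdmod) : {pred 'Hom(X, Y)} :=
  fun f => `[< forall (a : A) (x : X), f (act X a x) = act Y a (f x) >].

Arguments modhom_pred : clear implicits.

Record modhom (X Y : fdmod) := ModHom {
  modhom_fun :> 'Hom(X, Y);
  modhomP : modhom_fun \in modhom_pred X Y }.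

HB.instance Definition _ X Y := [isSub for @modhom_fun X Y].
HB.instance Definition _ X Y := [Choice of modhom X Y by <:].

Fact modhom_submod_closed X Y : submod_closed (modhom_pred X Y).
Proof.
split=> [|c f g /asboolP fP /asboolP gP].
  by apply/asboolP => a x; rewrite !lfunE /= linear0.
by apply/asboolP => a x; rewrite !lfunE /= !lfunE /= fP gP linearP.
Qed.

HB.instance Definition _ X Y :=
  GRing.isSubmodClosed.Build k _ (modhom_pred X Y) (@modhom_submod_closed X Y).
HB.instance Definition _ X Y := [SubChoice_isSubLmodule of modhom X Y by <:].

Fact modhom_id_subproof X : \1%VF \in modhom_pred X X.
Proof. by apply/asboolP => a x; rewrite !id_lfunE. Qed.
Definition modhom_id X : modhom X X := ModHom (modhom_id_subproof X).

Fact modhom_comp_subproof X Y Z (g : modhom Y Z) (f : modhom X Y) :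
  (modhom_fun g \o modhom_fun f)%VF \in modhom_pred X Z.
Proof.
apply/asboolP => a x; rewrite !comp_lfunE.
by have /asboolP-> := modhomP f; have /asboolP-> := modhomP g.
Qed.
Definition modhom_comp X Y Z (g : modhom Y Z) (f : modhom X Y) : modhom X Z :=
  ModHom (modhom_comp_subproof g f).

Definition invertible X Y (f : modhom X Y) : Prop :=
  exists g : modhom Y X,
    modhom_comp g f = modhom_id X /\ modhom_comp f g = modhom_id Y.

Definition iso (X Y : fdmod) : Prop := exists f : modhom X Y, invertible f.

Definition short_exact X Y Z (f : modhom X Y) (g : modhom Y Z) : Prop :=
  [/\ lker f = 0%VS, limg f = lker g & limg g = fullv].

Definition zero_mod (X : fdmod) : Prop := \dim {:X} = 0%N.

Definition stable (M : fdmod) (U : {vspace M}) : Prop :=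
  forall (a : A) (u : M), u \in U -> act M a u \in U.

Definition simple (S : fdmod) : Prop :=
  ~ zero_mod S /\
  forall U : {vspace S}, stable U -> U = 0%VS \/ U = fullv.

Definition direct_sum (Z X Y : fdmod) : Prop :=
  exists (i : modhom X Z) (j : modhom Y Z) (p : modhom Z X) (q : modhom Z Y),
    [/\ modhom_comp p i = modhom_id X, modhom_comp q j = modhom_id Y,
        modhom_comp p j = 0, modhom_comp q i = 0
      & modhom_comp i p + modhom_comp j q = modhom_id Z].

Definition indecomposable (M : fdmod) : Prop :=
  ~ zero_mod M /\
  forall X Y, direct_sum M X Y -> zero_mod X \/ zero_mod Y.

(* Additive inverses are covered by composing with - id. *)
Inductive rad : forall X Y, modhom X Y -> Prop :=
| rad_gen X Y (f : modhom X Y) :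
    indecomposable X -> indecomposable Y -> ~ invertible f -> rad f
| rad_zero X Y : rad (0 : modhom X Y)
| rad_add X Y (f g : modhom X Y) : rad f -> rad g -> rad (f + g)
| rad_compl X Y Z (g : modhom Y Z) (f : modhom X Y) :
    rad f -> rad (modhom_comp g f)
| rad_compr X Y Z (g : modhom Y Z) (f : modhom X Y) :
    rad g -> rad (modhom_comp g f).

(* Contains all zero modules, as empty direct sums. *)
Inductive add_closure (C : fdmod -> Prop) : fdmod -> Prop :=
| add_in X : C X -> add_closure C X
| add_zero X : zero_mod X -> add_closure C X
| add_sum Z X Y :
    direct_sum Z X Y -> add_closure C X -> add_closure C Y -> add_closure C Z
| add_summand Z X Y : direct_sum Z X Y -> add_closure C Z -> add_closure C X.

Definition factors_through (C : fdmod -> Prop) X Y (h : modhom X Y) : Prop :=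
  exists Z (f : modhom X Z) (g : modhom Z Y),
    add_closure C Z /\ h = modhom_comp g f.

(* [comp_factors M s]: M has a composition series whose successive simple    *)
(* factors are, up to isomorphism, the members of s, listed from the top.    *)
Inductive comp_factors : fdmod -> seq fdmod -> Prop :=
| comp_nil M : zero_mod M -> comp_factors M [::]
| comp_cons N M S s (f : modhom N M) (g : modhom M S) :
    short_exact f g -> simple S -> comp_factors N s ->
    comp_factors M (S :: s).

(* The Jordan-Hoelder multiplicity [M : S] is m. *)
Definition jh_mult (M S : fdmod) (m : nat) : Prop :=
  exists2 s, comp_factors M s & m = count (fun T => `[< iso T S >]) s.

Record simple_mod := SimpleMod {
  simple_obj :> fdmod;
  simple_objP : simple simple_obj }.

(* A function on the isomorphism classes of simple modules. *)
Record dimvec := DimVec {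
  dimvec_fun :> simple_mod -> nat;
  dimvec_iso : forall S T : simple_mod,
    iso S T -> dimvec_fun S = dimvec_fun T }.

Definition has_dimvec (M : fdmod) (e : dimvec) : Prop :=
  forall S : simple_mod, jh_mult M S (e S).

Section Submodule.

Variables (M : fdmod) (U : {vspace M}) (stabU : stable U).

Definition sub_act_fun (a : A) (u : subvs_of U) : subvs_of U :=
  vsproj U (act M a (vsval u)).

Fact sub_act_fun_linear a : linear (sub_act_fun a).
Proof. by move=> c u v; rewrite /sub_act_fun !linearP. Qed.
HB.instance Definition _ a :=
  GRing.isLinear.Build k _ _ _ (sub_act_fun a) (sub_act_fun_linear a).

Definition sub_act (a : A) : 'End(subvs_of U) := linfun (sub_act_fun a).

Fact sub_act_linear : linear sub_act.
Proof.
move=> c a b; apply/lfunP => u.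
by rewrite !lfunE /= !lfunE /= /sub_act_fun linearP !lfunE /= !lfunE /= linearP.
Qed.
HB.instance Definition _ :=
  GRing.isLinear.Build k _ _ _ sub_act sub_act_linear.

Fact sub_act1 : sub_act 1 = \1%VF.
Proof.
by apply/lfunP => u; rewrite !lfunE /= /sub_act_fun act1 id_lfunE vsvalK.
Qed.

Fact sub_actM a b : sub_act (a * b) = (sub_act a \o sub_act b)%VF.
Proof.
apply/lfunP => u; rewrite comp_lfunE !lfunE /= /sub_act_fun actM comp_lfunE.
by rewrite vsprojK //; apply/stabU/subvsP.
Qed.

Definition submod : fdmod := FdMod sub_act1 sub_actM.

End Submodule.

Definition quiver_grassmannian (M : fdmod) (e : dimvec) (U : {vspace M}) :
  Prop := exists stabU : stable U, has_dimvec (submod stabU) e.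

End Modules.

Arguments quiver_grassmannian {k A} M e U.

Section Functors.

Variables (k : fieldType) (A B : falgType k).

Record functor := Functor {
  fobj :> fdmod A -> fdmod B;
  fmap : forall X Y : fdmod A, {linear modhom X Y -> modhom (fobj X) (fobj Y)};
  fmap_id : forall X, fmap X X (modhom_id X) = modhom_id (fobj X);
  fmap_comp : forall X Y Z (g : modhom Y Z) (f : modhom X Y),
    fmap X Z (modhom_comp g f) = modhom_comp (fmap Y Z g) (fmap X Y f) }.

Definition exact_functor (F : functor) : Prop :=
  forall X Y Z (f : modhom X Y) (g : modhom Y Z),
    short_exact f g -> short_exact (fmap F _ _ f) (fmap F _ _ g).

Definition faithful_functor (F : functor) : Prop :=
  forall X Y, injective (fmap F X Y).

End Functors.

Definition controlled_wild (k : fieldType) (L : falgType k) : Prop :=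
  forall G : falgType k,
  exists (F : functor G L) (C : fdmod L -> Prop),
    [/\ exact_functor F, faithful_functor F &
     forall X Y : fdmod G,
     [/\ forall h : modhom (F X) (F Y), factors_through C h -> rad h,
         forall h : modhom (F X) (F Y), exists (f : modhom X Y) h',
           factors_through C h' /\ h = fmap F X Y f + h'
       & forall f : modhom X Y,
           factors_through C (fmap F X Y f) -> fmap F X Y f = 0]].

Section ProjectiveVarieties.

Variable k : fieldType.

(* A point of the projective space with N homogeneous coordinates, that is   *)
(* of P^(N-1): a line in k^N, whose nonzero vectors are the coordinates.     *)
Record projpt (N : nat) := ProjPt {
  line :> {vspace 'rV[k]_N};
  line_dim : \dim line = 1%N }.

Definition vanishes N (p : {mpoly k[N]}) (x : projpt N) : Prop :=
  forall v, v \in line x -> p.@[fun i => v 0 i] = 0.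

Definition zclosed N (Z : projpt N -> Prop) : Prop :=
  exists T : {mpoly k[N]} -> Prop,
    (forall p, T p -> exists d, p \is d.-homog) /\
    (forall x, Z x <-> forall p, T p -> vanishes p x).

(* phi is a morphism on X: near each point of X it is given by homogeneous   *)
(* polynomials of one degree without common zero.                            *)
Definition regular N P (X : projpt N -> Prop) (phi : projpt N -> projpt P) :
  Prop :=
  forall x, X x ->
  exists (Z : projpt N -> Prop) (d : nat) (f : 'I_P -> {mpoly k[N]}),
    [/\ zclosed Z, ~ Z x, forall j, f j \is d.-homog &
     forall y, X y -> ~ Z y ->
     forall v, v \in line y -> v != 0 ->
       let w := \row_j (f j).@[fun i => v 0 i] in
       w != 0 /\ w \in line (phi y)].

Definition variety_iso N P (X : projpt N -> Prop) (Y : projpt P -> Prop) :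
  Prop :=
  exists (phi : projpt N -> projpt P) (psi : projpt P -> projpt N),
    [/\ regular X phi, regular Y psi,
        forall x, X x -> Y (phi x) /\ psi (phi x) = x
      & forall y, Y y -> X (psi y) /\ phi (psi y) = y].

End ProjectiveVarieties.

Section Pluecker.

Variables (k : fieldType) (V : vectType k).
Let n := \dim {:V}.

(* Pluecker coordinates of U in the exterior algebra of V, whose standard    *)
(* basis is indexed by all subsets I of {0, .., n-1}: for #|I| = \dim U the  *)
(* maximal minor with columns I, and 0 otherwise. Thus the d-dimensional     *)
(* subspaces get their usual embedding in the linear subspace P(Lambda^d V). *)
Definition pluecker (U : {vspace V}) : 'rV[k]_#|{set 'I_n}| :=
  \row_m (let I : {set 'I_n} := enum_val m in
          if #|I| == \dim U then
            \det (\matrix_(i < #|I|, j < #|I|)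
                    coord (vbasis {:V}) (enum_val j) (vbasis U)`_i)
          else 0).

Definition pluecker_image (G : {vspace V} -> Prop)
    (x : projpt k #|{set 'I_n}|) : Prop :=
  exists2 U, G U & line x = <[pluecker U]>%VS.

End Pluecker.

(* Main.v *)
(* Let L = k (+) k^4 be the local algebra whose radical k^4 squares to zero,  *)
(* and let V consist of two points of P^1.                                   *)
(*                                                                           *)
(* All simple L-modules are one-dimensional and isomorphic, so a quiver      *)
(* Grassmannian of M consists of all submodules of M of some dimension d. If *)
(* U1 <> U2 are two of them, with intersection I, choose a hyperplane H of   *)
(* U1 that contains I and rad U1, a vector a in U1 outside H, and a vector b *)
(* in U2 outside I which the radical maps to I. Then H + <a + b> is a third  *)
(* one, so that no quiver Grassmannian has exactly two points.               *)
(*                                                                           *)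
(* For wildness, an algebra G with basis g_0, .., g_(N-1) and a G-module X,  *)
(* put P = X^(N+1) and let L act on P (+) P through four operators P -> P:   *)
(* the shift, the projection to the first summand, diag(g_0, .., g_(N-1), 0) *)
(* and the identity. Modulo the maps from the top P to the socle P, which    *)
(* are those factoring through a semisimple module, a homomorphism is a map  *)
(* commuting with the four operators, that is, a G-homomorphism applied to   *)
(* every summand. No simple module is a direct summand of P (+) P, hence all *)
(* maps through semisimple modules are in the radical.                       *)

Require Import Defs.
From HB Require Import structures.
From mathcomp Require Import all_boot all_order all_algebra all_field.
From mathcomp Require Import perm boolp mpoly.

Set Implicit Arguments.
Unset Strict Implicit.
Unset Printing Implicit Defensive.

Import GRing.Theory.
Local Open Scope ring_scope.

(** * Square-zero extensions and their modules *)

(** Over [L] a dimension vector carries no more than a dimension, yet the [L]-modules include all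
    representations of the Kronecker quiver with four arrows. The first fact bounds the varieties
    that occur, the second gives wildness.

    Non-realizability is a count of points. An isomorphism of varieties is in particular a
    bijection, and subspaces of one dimension are determined by their Pluecker lines
    ([pluecker_inj]). By [quiver_grassmannian_dim], every stable subspace of the right dimension
    belongs to the Grassmannian, and [third_submodule] builds a third member from any two. The two
    points [axes] are therefore excluded ([axes_not_grassmannian]).

    For wildness, one of the four operators is the identity. This makes every homomorphism block
    triangular with equal diagonal blocks ([kron_hom_decomp]). The diagonal block commutes with the
    other operators, hence comes from a [G]-homomorphism ([intertwines_pointwise]); the remaining
    block factors through a module killed by the radical. Maps of the latter kind vanish on the
    bottom copy of [P] ([kron_factor_bot]), so they meet the image of the functor only in 0, and
    they are radical maps ([kron_factor_rad]). *)

Definition sqzero_ext (k : fieldType) (W : vectType k) : Type := (k^o * W)%type.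

Section SquareZeroExtension.

Variables (k : fieldType) (W : vectType k).
Local Notation L := (sqzero_ext W).

HB.instance Definition _ := Vector.copy L (k^o * W)%type.

(* Retyping [x.1] from [k^o] to [k] makes it scale over [k] and not over the *)
(* regular module.                                                           *)
Definition scalar_part (x : L) : k := x.1.
Definition radical_part (x : L) : W := x.2.

Lemma sqzero_eq (x y : L) :
  scalar_part x = scalar_part y -> radical_part x = radical_part y -> x = y.
Proof. by case: x y => ? ? [? ?] /= -> ->. Qed.

Definition sqzero_mul (x y : L) : L :=
  (scalar_part x * scalar_part y,
   scalar_part x *: radical_part y + scalar_part y *: radical_part x).

Fact sqzero_mulA : associative sqzero_mul.
Proof.
move=> x y z; rewrite /sqzero_mul /= mulrA; congr (_, _).
rewrite !scalerDr !scalerA -addrA.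
by rewrite [scalar_part z * _]mulrC [scalar_part z * _]mulrC.
Qed.

Fact sqzero_mulC : commutative sqzero_mul.
Proof. by move=> x y; rewrite /sqzero_mul mulrC addrC. Qed.

Fact sqzero_mul1 : left_id ((1, 0) : L) sqzero_mul.
Proof. by case=> a w; rewrite /sqzero_mul /= mul1r scale1r scaler0 addr0. Qed.

Fact sqzero_mulDl : left_distributive sqzero_mul +%R.
Proof.
move=> x y z; rewrite /sqzero_mul /= mulrDl; congr (_, _).
by rewrite scalerDl scalerDr addrACA.
Qed.

Fact sqzero_1neq0 : ((1, 0) : L) != 0.
Proof. by apply/eqP => -[/eqP]; rewrite oner_eq0. Qed.

HB.instance Definition _ := GRing.Zmodule_isComNzRing.Build L
  sqzero_mulA sqzero_mulC sqzero_mul1 sqzero_mulDl sqzero_1neq0.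

Fact sqzero_scaleAl (a : k) (x y : L) : a *: (x * y) = (a *: x) * y.
Proof.
congr (_, _) => /=; first exact: mulrA.
by rewrite [LHS]scalerDr !scalerA [scalar_part y * _]mulrC.
Qed.

HB.instance Definition _ := GRing.Lmodule_isLalgebra.Build k L sqzero_scaleAl.
HB.instance Definition _ := GRing.Lalgebra_isComAlgebra.Build k L.
HB.instance Definition _ := Algebra_isFalgebra.Build k L.

End SquareZeroExtension.

Lemma dim_addv_line (k : fieldType) (V : vectType k) (A : {vspace V}) b :
  b \notin A -> \dim (A + <[b]>) = (\dim A).+1.
Proof.
move=> bA; have b0 : b != 0 by apply: contraNneq bA => ->; rewrite mem0v.
rewrite dimv_disjoint_sum ?dim_vline ?b0 ?addn1 //.
apply/eqP; rewrite -subv0; apply/subvP => v; rewrite memv_cap => /andP[vA].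
case/vlineP=> c Dv; rewrite memv0; have [c0|c0] := eqVneq c 0.
  by rewrite Dv c0 scale0r.
by rewrite Dv rpredZeq (negPf c0) (negPf bA) in vA.
Qed.

(** * Modules over a square-zero extension, and exchange of submodules *)

Section SquareZeroModules.

Variables (k : fieldType) (W : vectType k).
Local Notation L := (sqzero_ext W).

Definition radact (M : fdmod L) (w : W) : 'End(M) := act M ((0, w) : L).

Lemma actE (M : fdmod L) (x : L) (m : M) :
  act M x m = scalar_part x *: m + radact M (radical_part x) m.
Proof.
have {1}->: x = scalar_part x *: (1 : L) + ((0, radical_part x) : L).
  apply: sqzero_eq; first by rewrite [RHS]addr0 [RHS]mulr1.
  by rewrite [RHS]/= scaler0 add0r.
by rewrite linearP act1 add_lfunE scale_lfunE id_lfunE.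
Qed.

Lemma radactK (M : fdmod L) (v w : W) (m : M) : radact M v (radact M w m) = 0.
Proof.
rewrite /radact -comp_lfunE -actM.
suff ->: ((0, v) : L) * ((0, w) : L) = 0 by rewrite linear0 lfunE.
by apply: sqzero_eq; rewrite /= ?mul0r // !scale0r addr0.
Qed.

Lemma stable_radact (M : fdmod L) (U : {vspace M}) :
  (forall w u, u \in U -> radact M w u \in U) -> stable U.
Proof. by move=> sU x u uU; rewrite actE memvD ?memvZ ?sU. Qed.

Lemma modhom_radact (X Y : fdmod L) (f : modhom X Y) w x :
  f (radact X w x) = radact Y w (f x).
Proof. by have /asboolP := modhomP f; apply. Qed.

Lemma radact_modhom (X Y : fdmod L) (f : 'Hom(X, Y)) :
  (forall w x, f (radact X w x) = radact Y w (f x)) ->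
  f \in @modhom_pred k L X Y.
Proof.
move=> fP; apply/asboolP => a x.
by rewrite (@actE X) (@actE Y) linearD linearZ /= fP.
Qed.

Section SquareZeroAction.

Variables (Q : vectType k) (rho : {linear W -> 'End(Q)}).
Hypothesis rho2 : forall v w q, rho v (rho w q) = 0.

Definition sqzero_act (x : L) : 'End(Q) :=
  scalar_part x *: \1%VF + rho (radical_part x).

Fact sqzero_act_linear : linear sqzero_act.
Proof.
move=> c x y; rewrite /sqzero_act.
have ->: scalar_part (c *: x + y) = c * scalar_part x + scalar_part y by [].
have ->: radical_part (c *: x + y) = c *: radical_part x + radical_part y by [].
by rewrite linearP scalerDr addrACA scalerA scalerDl.
Qed.
HB.instance Definition _ :=
  GRing.isLinear.Build k _ _ _ sqzero_act sqzero_act_linear.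

Fact sqzero_act1 : sqzero_act 1 = \1%VF.
Proof. by rewrite /sqzero_act linear0 addr0 scale1r. Qed.

Fact sqzero_actM x y : sqzero_act (x * y) = (sqzero_act x \o sqzero_act y)%VF.
Proof.
apply/lfunP => q; rewrite /sqzero_act.
have ->: scalar_part (x * y) = scalar_part x * scalar_part y by [].
have ->: radical_part (x * y)
  = scalar_part x *: radical_part y + scalar_part y *: radical_part x by [].
rewrite comp_lfunE !add_lfunE !scale_lfunE !id_lfunE.
rewrite [rho (_ + _)]linearD !linearZ [rho _ (_ + _)]linearD linearZ /=.
rewrite rho2 addr0.
by rewrite add_lfunE !scale_lfunE scalerDr scalerA addrA.
Qed.

Definition sqzero_mod : fdmod L := FdMod sqzero_act1 sqzero_actM.

Lemma radact_sqzero_mod w : radact sqzero_mod w = rho w.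
Proof. by rewrite /radact /= /sqzero_act /= scale0r add0r. Qed.

End SquareZeroAction.

Fact null_act2 (Q : vectType k) (v w : W) (q : Q) :
  (\0 : W -> 'End(Q)) v ((\0 : W -> 'End(Q)) w q) = 0.
Proof. by rewrite lfunE. Qed.

Definition trivial_mod (Q : vectType k) : fdmod L := sqzero_mod (@null_act2 Q).

Lemma radact_trivial Q w q : radact (trivial_mod Q) w q = 0.
Proof. by rewrite radact_sqzero_mod lfunE. Qed.

(** The nonzero quotient [U / A] has a nonzero socle: either the radical maps a chosen [u] outside
    [A] into [A], or some [radact M w u] is outside [A], and a second application of the radical
    gives 0. *)
Lemma stable_step (M : fdmod L) (A U : {vspace M}) :
    stable A -> stable U -> (A <= U)%VS -> A <> U ->
  exists b, [/\ b \in U, b \notin A & forall w, radact M w b \in A].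
Proof.
move=> sA sU sAU neAU.
have /subvPn[u uU uA] : ~~ (U <= A)%VS.
  by apply/negP => sUA; apply/neAU/subv_anti/andP.
have [ru|/existsNP[w /negP rwu]] := pselect (forall w, radact M w u \in A).
  by exists u.
exists (radact M w u); split => //; first exact: sU.
by move=> v; rewrite radactK mem0v.
Qed.

Lemma stable_addv_line (M : fdmod L) (A : {vspace M}) b :
  stable A -> (forall w, radact M w b \in A) -> stable (A + <[b]>)%VS.
Proof.
move=> sA bA; apply: stable_radact => w u /memv_addP[a aA [_ /vlineP[c ->] ->]].
rewrite linearD linearZ /=.
by apply: (subvP (addvSl _ _)); rewrite memvD ?memvZ //; apply: sA.
Qed.

(** Socle vectors from [stable_step] are added to [A] one at a time; the stage just before [U] is
    reached is the hyperplane [H], and the last vector added is [a]. *)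
Lemma stable_hyperplane (M : fdmod L) (A U : {vspace M}) :
    stable A -> stable U -> (A <= U)%VS -> A <> U ->
  exists (H : {vspace M}) (a : M),
    [/\ stable H, (A <= H)%VS, U = (H + <[a]>)%VS, a \notin H
      & forall w u, u \in U -> radact M w u \in H].
Proof.
move=> sA sU; have [n] := ubnP (\dim U - \dim A).
elim: n A sA => // n IHn A sA ltn sAU neAU.
have [b [bU bA rb]] := stable_step sA sU sAU neAU.
have sB := stable_addv_line sA rb.
have sBU : (A + <[b]> <= U)%VS by rewrite subv_add sAU -memvE.
have [BU|neBU] := pselect ((A + <[b]>)%VS = U).
  exists A, b; split=> // w u; rewrite -BU => /memv_addP[a aA].
  move=> [_ /vlineP[c ->] ->]; rewrite linearD linearZ /=.
  by rewrite memvD ?memvZ //; apply: sA.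
have [|H [a [sH sBH DU aH rU]]] := IHn _ sB _ sBU neBU.
  have := dimvS sBU; rewrite dim_addv_line // => ltAU.
  by rewrite subnS prednK ?subn_gt0.
by exists H, a; split => //; apply: subv_trans sBH; apply: addvSl.
Qed.

(** Only one vector of [U1] is exchanged, [a] for [a + b]. The sum [H + <[a + b]>] is stable because
    [H] contains the radical multiples of both [a] and [b]. The vector [a + b] is outside [U1]
    because [b] is, and outside [U2] because otherwise [a] would lie in [I], hence in [H]. *)
Lemma third_submodule (M : fdmod L) (U1 U2 : {vspace M}) :
    stable U1 -> stable U2 -> \dim U1 = \dim U2 -> U1 <> U2 ->
  exists U : {vspace M}, [/\ stable U, \dim U = \dim U1, U <> U1 & U <> U2].
Proof.
move=> sU1 sU2 dU neU.
set I := (U1 :&: U2)%VS.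
have sI : stable I.
  by move=> x u; rewrite !memv_cap => /andP[? ?]; rewrite sU1 ?sU2.
have neI1 : I <> U1.
  move=> DI; apply/neU/eqP; rewrite eqEdim dU leqnn andbT.
  by rewrite -DI capvSr.
have neI2 : I <> U2.
  move=> DI; apply/neU/esym/eqP; rewrite eqEdim dU leqnn andbT.
  by rewrite -DI capvSl.
have [H [a [sH sIH DU1 aH rU1]]] := stable_hyperplane sI sU1 (capvSl _ _) neI1.
have [b [bU2 bI rb]] := stable_step sI sU2 (capvSr _ _) neI2.
have sHU1 : (H <= U1)%VS by rewrite DU1 addvSl.
have aU1 : a \in U1 by rewrite DU1 memvE addvSr.
have bU1 : b \notin U1 by move: bI; rewrite memv_cap bU2 andbT.
have abU1 : a + b \notin U1 by rewrite rpredDl.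
have abH : a + b \notin H by apply: contra abU1; apply/subvP.
exists (H + <[a + b]>)%VS; split.
- apply: stable_addv_line => // w; rewrite linearD /= memvD //.
    exact: rU1.
  by apply: (subvP sIH); apply: rb.
- by rewrite DU1 !dim_addv_line.
- by move=> DU; case/negP: abU1; rewrite -DU memvE addvSr.
- move=> DU; have abU2 : a + b \in U2 by rewrite -DU memvE addvSr.
  have aU2 : a \in U2 by rewrite -(addrK b a) memvB.
  by case/negP: aH; apply: (subvP sIH); rewrite memv_cap aU1.
Qed.

End SquareZeroModules.

(** * Dimension vectors *)

Section LineMap.

Variables (k : fieldType) (V V' : vectType k) (a : V) (b : V').

(** The coordinate of the one-element family [[tuple a]] is a linear form on the whole of [V], with
    value 1 at [a] if [a] is nonzero. *)
Definition line_map (v : V) : V' := coord [tuple a] ord0 v *: b.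

Fact line_map_linear : linear line_map.
Proof. by move=> c u v; rewrite /line_map linearP scalerDl scalerA. Qed.
HB.instance Definition _ :=
  GRing.isLinear.Build k _ _ _ line_map line_map_linear.

Lemma line_map_id : a != 0 -> line_map a = b.
Proof.
move=> a0; rewrite /line_map -[X in coord _ _ X]/([tuple a]`_(ord0 : 'I_1)).
by rewrite coord_free ?eqxx ?scale1r // /free span_seq1 dim_vline a0.
Qed.

End LineMap.
Arguments line_map : simpl never.

Lemma hyperplane_functional (k : fieldType) (V : vectType k)
    (H : {vspace V}) a :
    a \notin H -> fullv = (H + <[a]>)%VS ->
  exists phi : 'Hom(V, k^o), lker phi = H /\ limg phi = fullv.
Proof.
move=> aH DV; have a0 : a != 0 by apply: contraNneq aH => ->; rewrite mem0v.
have aI : (<[a]> :&: H = 0)%VS.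
  apply/eqP; rewrite -subv0; apply/subvP => v; rewrite memv_cap => /andP[].
  case/vlineP=> c ->; rewrite rpredZeq (negPf aH) orbF => /eqP->.
  by rewrite scale0r mem0v.
pose phi := linfun (line_map a (1 : k^o) \o daddv_pi <[a]> H).
have phiE v : phi v = line_map a (1 : k^o) (daddv_pi <[a]> H v).
  by rewrite lfunE.
exists phi; split.
  apply/vspaceP => v; rewrite memv_ker phiE.
  have /memv_addP[h hH [_ /vlineP[c ->] ->]] : v \in (H + <[a]>)%VS.
    by rewrite -DV memvf.
  (* The two projections of [<[a]> + H] add up to the identity, and the one onto [H] already fixes
     [h]. *)
  have h0 : daddv_pi <[a]> H h = 0.
    have := daddv_pi_add aI (subvP (addvSr <[a]> H) _ hH).
    rewrite capvC in aI; rewrite (daddv_pi_id aI hH) => /(canRL (addrK _)).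
    by rewrite subrr.
  rewrite [daddv_pi _ _ _]linearD /= h0 add0r.
  rewrite (daddv_pi_id aI) ?memvZ ?memv_line //.
  rewrite linearZ /= line_map_id // [_ *: _]mulr1.
  by rewrite rpredDl // rpredZeq (negPf aH) orbF.
apply/vspaceP => c; rewrite memvf; apply/memv_imgP; exists (c *: a).
  by rewrite memvf.
rewrite linearZ /= phiE (daddv_pi_id aI) ?memv_line // line_map_id //.
by rewrite [RHS]mulr1.
Qed.

(** * Simple modules and composition series over a local square-zero algebra *)

Section JordanHolder.

Variables (k : fieldType) (W : vectType k).
Local Notation L := (sqzero_ext W).

(** If [radact S w x] were nonzero, the stable line it spans would be all of [S]; then [x] would be
    a multiple of it and be killed by [w]. *)
Lemma simple_radact (S : fdmod L) w (x : S) : simple S -> radact S w x = 0.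
Proof.
move=> [_ simS]; apply/eqP; apply/negPn/negP => wx0.
have sY : stable <[radact S w x]>.
  apply: stable_radact => v _ /vlineP[c ->].
  by rewrite linearZ /= radactK scaler0 mem0v.
case: (simS _ sY) => [/eqP|fullY].
  by rewrite -dimv_eq0 dim_vline wx0.
have : x \in <[radact S w x]>%VS by rewrite fullY memvf.
case/vlineP=> c Dx; case/eqP: wx0.
by rewrite Dx linearZ /= radactK scaler0.
Qed.

Lemma nonzero_mod (M : fdmod L) : ~ zero_mod M -> exists x : M, x != 0.
Proof.
move=> nzM; apply: contrapT => /forallNP S0; case: nzM; apply/eqP.
rewrite dimv_eq0 -subv0; apply/subvP => x _; rewrite memv0.
exact/negPn/negP/S0.
Qed.

Lemma simple_line (S : fdmod L) : simple S ->
  exists2 x : S, x != 0 & <[x]>%VS = fullv.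
Proof.
move=> simS; have [nz0 simS2] := simS.
have [x x0] := nonzero_mod nz0; exists x => //.
have sx : stable <[x]>.
  by apply: stable_radact => w u _; rewrite simple_radact // mem0v.
by case: (simS2 _ sx) => // /eqP; rewrite -dimv_eq0 dim_vline x0.
Qed.

Lemma simple_dim (S : fdmod L) : simple S -> \dim {:S} = 1%N.
Proof. by case/simple_line=> x x0 <-; rewrite dim_vline x0. Qed.

Lemma simple_iso (S T : fdmod L) : simple S -> simple T -> iso S T.
Proof.
move=> simS simT; have [s s0 Ds] := simple_line simS.
have [t t0 Dt] := simple_line simT.
have homP (X Y : fdmod L) (f : 'Hom(X, Y)) : simple X -> simple Y ->
    f \in @modhom_pred k L X Y.
  move=> simX simY; apply: radact_modhom => w x.
  by rewrite !simple_radact // linear0.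
exists (ModHom (homP _ _ (linfun (line_map s t)) simS simT)).
exists (ModHom (homP _ _ (linfun (line_map t s)) simT simS)).
have st : linfun (line_map s t) s = t by rewrite lfunE /= line_map_id.
have ts : linfun (line_map t s) t = s by rewrite lfunE /= line_map_id.
split; apply/val_inj/lfunP => x /=; rewrite comp_lfunE id_lfunE.
  have /vlineP[c ->] : x \in <[s]>%VS by rewrite Ds memvf.
  by rewrite !linearZ /= st ts.
have /vlineP[c ->] : x \in <[t]>%VS by rewrite Dt memvf.
by rewrite !linearZ /= ts st.
Qed.

Lemma trivial_simple : simple (trivial_mod W k^o).
Proof.
split=> [|U _]; first by rewrite /zero_mod dimvf.
have: (\dim U <= 1)%N by rewrite (leq_trans (dimvS (subvf U))) // dimvf.
rewrite leq_eqVlt ltnS leqn0 => /orP[/eqP dU|]; last first.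
  by rewrite dimv_eq0 => /eqP; left.
by right; apply/eqP; rewrite eqEdim subvf dU dimvf.
Qed.

(** All simple modules are isomorphic, so every factor is counted, and each contributes dimension
    1. *)
Lemma comp_factors_count (M : fdmod L) s : comp_factors M s ->
  forall S, simple S -> count (fun T => `[< iso T S >]) s = \dim {:M}.
Proof.
elim=> [{}M M0 S _ //|{}M N T {}s f g].
move=> [kf ig lg] simT _ IHs S simS /=; rewrite IHs //.
have /asboolP-> := simple_iso simT simS.
rewrite -(limg_ker_dim g fullv) lg (simple_dim simT) capfv -ig.
by rewrite limg_dim_eq ?kf ?capv0 // addnC.
Qed.

Lemma comp_factors_exist (M : fdmod L) :
  exists s, comp_factors M s.
Proof.
have [n] := ubnP (\dim {:M}); elim: n M => // n IHn M; rewrite ltnS => dM.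
have [M0|M0] := pselect (zero_mod M); first by exists [::]; apply: comp_nil.
have s0 : stable (0%VS : {vspace M}).
  by move=> x u; rewrite !memv0 => /eqP->; rewrite linear0.
have sf : stable (fullv : {vspace M}) by move=> x u _; rewrite memvf.
have nef : (0%VS : {vspace M}) <> fullv.
  by move=> Df; apply: M0; rewrite /zero_mod -Df dimv0.
(* [H] contains the radical of [M], so the linear form with kernel [H] is a homomorphism onto the
   trivial simple module; this is the top factor of the series. *)
have [H [a [sH _ DM aH rM]]] := stable_hyperplane s0 sf (sub0v _) nef.
have [phi [kphi iphi]] := hyperplane_functional aH DM.
have phiP : phi \in @modhom_pred k L M (trivial_mod W k^o).
  apply: radact_modhom => w x; rewrite radact_trivial.
  by apply/eqP; rewrite -memv_ker kphi rM ?memvf.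
have inclP : linfun vsval \in @modhom_pred k L (submod sH) M.
  apply/asboolP => x u; rewrite !lfunE /= /sub_act_fun vsprojK //.
  exact/sH/subvsP.
have [|s cs] := IHn (submod sH).
  have: \dim H = \dim {:submod sH} by rewrite dimvf.
  by move: dM; rewrite DM dim_addv_line // => /[swap] <-.
exists (trivial_mod W k^o :: s).
apply: (comp_cons (f := ModHom inclP) (g := ModHom phiP)) => //; last first.
  exact: trivial_simple.
split=> //=.
  apply/eqP/lker0P => u v; rewrite !lfunE; exact: val_inj.
apply/vspaceP => v; rewrite kphi; apply/memv_imgP/idP => [[u _ ->]|vH].
  by rewrite lfunE /= subvsP.
by exists (vsproj H v); rewrite ?memvf // lfunE /= vsprojK.
Qed.

Lemma has_dimvecP (M : fdmod L) (e : dimvec L) :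
  has_dimvec M e <-> forall S : simple_mod L, e S = \dim {:M}.
Proof.
split=> [He S|He S].
  have [s cs ->] := He S; apply: comp_factors_count => //.
  exact: simple_objP.
have [s cs] := comp_factors_exist M; exists s => //.
by rewrite He (comp_factors_count cs) //; apply: simple_objP.
Qed.

(** A known member [U] serves to read off the dimension encoded in [e]. *)
Lemma quiver_grassmannian_dim (M : fdmod L) e (U U' : {vspace M}) :
    quiver_grassmannian M e U ->
  (quiver_grassmannian M e U' <-> stable U' /\ \dim U' = \dim U).
Proof.
have dimsub (V : {vspace M}) (sV : stable V) : \dim {:submod sV} = \dim V.
  exact: dimvf.
move=> [sU /has_dimvecP HU]; split=> [[sU' /has_dimvecP HU']|[sU' dU]].
  split=> //; rewrite -(dimsub _ sU) -(HU (SimpleMod trivial_simple)).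
  by rewrite HU' dimsub.
by exists sU'; apply/has_dimvecP => S; rewrite HU !dimsub.
Qed.

End JordanHolder.

(** * The Pluecker embedding *)

Section Minors.

Variables (k : fieldType) (d n : nat).
Implicit Types (B : 'M[k]_(d, n)) (f g : 'I_d -> 'I_n).

(** Cramer's rule, by Laplace expansion along the replaced column. *)
Lemma adj_colsub_mul B f i j :
  (\adj (colsub f B) *m B) i j =
  \det (colsub (fun l => if l == i then j else f l) B).
Proof.
rewrite (expand_det_col _ i) !mxE; apply: eq_bigr => l _.
rewrite !mxE eqxx mulrC; congr (_ * _); rewrite /cofactor; congr (_ * \det _).
by apply/matrixP => u v; rewrite !mxE eq_sym (negPf (neq_lift _ _)).
Qed.

(** By Cramer's rule the matrices [\adj (colsub f B') *m B'] and [\adj (colsub f B) *m B] are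
    proportional; multiplying by [colsub f B] turns the second into a nonzero multiple of [B]. *)
Lemma eq_minors_submx B B' c f :
    (forall g, \det (colsub g B') = c * \det (colsub g B)) ->
    \det (colsub f B') != 0 ->
  exists K : 'M_d, B = K *m B'.
Proof.
move=> eqBB' P'0; have := P'0; rewrite eqBB' mulf_eq0 negb_or => /andP[c0 P0].
exists ((c * \det (colsub f B))^-1 *: (colsub f B *m \adj (colsub f B'))).
rewrite -scalemxAl -mulmxA.
have ->: \adj (colsub f B') *m B' = c *: (\adj (colsub f B) *m B).
  by apply/matrixP => i j; rewrite [RHS]mxE !adj_colsub_mul eqBB'.
rewrite -scalemxAr scalerA mulmxA mul_mx_adj mul_scalar_mx scalerA.
by rewrite -mulrA mulVf ?scale1r ?mulf_neq0.
Qed.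

Lemma det_colsub_noninj B f : ~ injective f -> \det (colsub f B) = 0.
Proof.
move=> ninjf; have /injectivePn[i [j ij fij]] : ~~ injectiveb f.
  by apply/injectiveP.
rewrite -det_tr (determinant_alternate ij) // => l.
by rewrite !mxE fij.
Qed.

Lemma row_free_minor B : row_free B ->
  exists2 f, injective f & \det (colsub f B) != 0.
Proof.
rewrite /row_free -mxrank_tr => fB.
exists (fullrankfun fB); first exact: fullrankfun_inj.
rewrite -unitfE -unitmxE -unitmx_tr.
rewrite (_ : _^T = rowsub (fullrankfun fB) B^T) ?fullrowsub_unit //.
by apply/matrixP => i j; rewrite !mxE.
Qed.

(** Two enumerations of the same columns differ by a permutation, whose sign is [b]. It is chosen
    before [E], hence common to all matrices; rows of [E] are indexed by [nat] so that one [E]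
    serves both sizes [m] and [d]. *)
Lemma det_reindex_image (m : nat) (g : 'I_m -> 'I_n) f :
    m = d -> injective f -> (forall i, exists j, f i = g j) ->
  exists b : bool, forall (E : nat -> 'I_n -> k),
    \det (\matrix_(i < m, j < m) E i (g j)) =
    (-1) ^+ b * \det (\matrix_(i < d, j < d) E i (f j)).
Proof.
move=> Dm; case: d / Dm f => f injf /choice[s Ds].
have injs : injective s by move=> i j sij; apply: injf; rewrite !Ds sij.
exists (odd_perm (perm injs)) => // E.
set B := \matrix_(i, j) E i (g j).
have ->: \matrix_(i, j) E i (f j) = col_perm (perm injs) B.
  by apply/matrixP => i j; rewrite !mxE permE Ds.
rewrite col_permE det_mulmx det_perm odd_permV mulrCA.
by rewrite -signr_addb addbb mulr1.
Qed.

End Minors.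

Section PlueckerEmbedding.

Variables (k : fieldType) (V : vectType k).
Local Notation n := (\dim {:V}).

(** The row count [d] is separate from [\dim U], so that subspaces of equal dimension get matrices
    of one type. *)
Definition coord_mx (d : nat) (U : {vspace V}) : 'M[k]_(d, n) :=
  \matrix_(i < d, j < n) coord (vbasis {:V}) j (vbasis U)`_i.

Lemma coord_mx_free (U : {vspace V}) : row_free (coord_mx (\dim U) U).
Proof.
apply: inj_row_free => u uB0.
have u0 : \sum_i u 0 i *: (vbasis U)`_i = 0.
  rewrite [LHS](coord_vbasis (memvf _)) big1 // => j _.
  rewrite linear_sum (_ : \sum_i _ = (u *m coord_mx (\dim U) U) 0 j).
    by rewrite uB0 mxE scale0r.
  by rewrite mxE; apply: eq_bigr => i _; rewrite linearZ mxE.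
have /freeP/(_ _ u0) u0' := basis_free (vbasisP U).
by apply/rowP => i; rewrite u0' mxE.
Qed.

Lemma coord_mx_sub d (U U' : {vspace V}) K :
    \dim U = d -> \dim U' = d -> coord_mx d U = K *m coord_mx d U' ->
  (U <= U')%VS.
Proof.
move=> dU dU' DK; rewrite -[U](span_basis (vbasisP U)).
apply/span_subvP => v /(nthP 0)[i ltiU <-].
have ltid : (i < d)%N by rewrite -dU -(size_tuple (vbasis U)).
rewrite [_`_i](coord_vbasis (memvf _)).
have DB j : coord (vbasis {:V}) j (vbasis U)`_i =
    \sum_l K (Ordinal ltid) l * coord (vbasis {:V}) j (vbasis U')`_l.
  have /matrixP/(_ (Ordinal ltid) j) := DK; rewrite !mxE => ->.
  by apply: eq_bigr => l _; rewrite mxE.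
under eq_bigr do rewrite DB scaler_suml.
rewrite exchange_big memv_suml // => l _.
under eq_bigr do rewrite -scalerA.
rewrite -scaler_sumr -(coord_vbasis (memvf _)) memvZ // vbasis_mem //.
by rewrite mem_nth // size_tuple dU'.
Qed.

(** Coordinate and sign depend on [f] alone, so the sign cancels when two subspaces are compared. *)
Lemma pluecker_minor d (f : 'I_d -> 'I_n) : injective f ->
  exists (i : 'I_#|{set 'I_n}|) (b : bool), forall U : {vspace V},
    \dim U = d -> pluecker U 0 i = (-1) ^+ b * \det (colsub f (coord_mx d U)).
Proof.
move=> injf; set I := f @: setT.
have cI : #|I| = d by rewrite card_imset // cardsT card_ord.
have fI i : exists j : 'I_#|I|, f i = enum_val j.
  have fiI : f i \in I by apply: imset_f; rewrite inE.
  by exists (enum_rank_in fiI (f i)); rewrite enum_rankK_in.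
have [b Hb] := det_reindex_image k cI injf fI.
exists (enum_rank I), b => U dU; rewrite mxE enum_rankK /=.
rewrite (introT eqP (etrans cI (esym dU))).
rewrite (Hb (fun i j => coord (vbasis {:V}) j (vbasis U)`_i)).
by congr (_ * \det _); apply/matrixP => i j; rewrite !mxE.
Qed.

Lemma pluecker_neq0 (U : {vspace V}) : pluecker U != 0.
Proof.
have [f injf Pf] := row_free_minor (coord_mx_free U).
have [i [b /(_ U erefl) Db]] := pluecker_minor injf.
by apply/eqP => /rowP/(_ i)/eqP; rewrite Db mxE mulf_eq0 signr_eq0 (negPf Pf).
Qed.

Lemma pluecker_inj (U U' : {vspace V}) :
    \dim U = \dim U' -> <[pluecker U]>%VS = <[pluecker U']>%VS -> U = U'.
Proof.
move=> dU eqL.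
have /vlineP[c Dc] : pluecker U' \in <[pluecker U]>%VS.
  by rewrite eqL memv_line.
have [f injf Pf] := row_free_minor (coord_mx_free U').
have eqB g : \det (colsub g (coord_mx (\dim U') U')) =
    c * \det (colsub g (coord_mx (\dim U') U)).
  have [injg|?] := pselect (injective g); last first.
    by rewrite !det_colsub_noninj // mulr0.
  have [i [b Db]] := pluecker_minor injg.
  have /rowP/(_ i) := Dc; rewrite [in RHS]mxE !Db // mulrCA.
  by move/(mulfI _); apply; rewrite signr_eq0.
have [K DK] := eq_minors_submx eqB Pf.
by apply/eqP; rewrite eqEdim (coord_mx_sub _ _ DK) // dU leqnn.
Qed.

End PlueckerEmbedding.

(** * Two points are not a quiver Grassmannian *)

Section TwoPoints.

Variable k : fieldType.

Lemma projpt_eq N (x y : projpt k N) : line x = line y -> x = y.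
Proof.
case: x y => x hx [y hy] /= Dx; rewrite {x}Dx in hx *.
by congr ProjPt; apply: eq_irrelevance.
Qed.

Fact axis_dim (i : 'I_2) : \dim <[delta_mx 0 i : 'rV[k]_2]> = 1%N.
Proof.
rewrite dim_vline; suff -> : delta_mx 0 i != 0 :> 'rV[k]_2 by [].
by apply/eqP => /rowP/(_ i)/eqP; rewrite !mxE !eqxx oner_eq0.
Qed.

Definition axis (i : 'I_2) : projpt k 2 := ProjPt (axis_dim i).

Definition axes (x : projpt k 2) : Prop := vanishes ('X_0 * 'X_1) x.

Lemma zclosed_axes : zclosed axes.
Proof.
exists (fun p => p = 'X_0 * 'X_1); split=> [p ->|x].
  by exists (1 + 1)%N; apply: dhomogM; rewrite dhomogX; apply/eqP/mdeg1.
by split=> [Vx p ->|]; last apply.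
Qed.

Lemma axesP x : axes x <-> exists i, x = axis i.
Proof.
have ev (v : 'rV[k]_2) : ('X_0 * 'X_1 : {mpoly k[2]}).@[fun i => v 0 i] =
    v 0 0 * v 0 1.
  by rewrite mevalM !mevalXU.
split=> [Vx|[i ->]]; last first.
  move=> v /= /vlineP[c ->]; rewrite ev !mxE.
  by case: i => [[|[|//]]] ? /=; rewrite ?mulr0 ?mul0r.
have [v vx v0] : exists2 v, v \in line x & v != 0.
  exists (vpick (line x)); first exact: memv_pick.
  by rewrite vpick0 -dimv_eq0 line_dim.
have Dx i : v = v 0 i *: delta_mx 0 i -> x = axis i.
  move=> Dv; apply: projpt_eq; apply/esym/eqP; rewrite eqEdim /=.
  rewrite line_dim axis_dim leqnn andbT -memvE.
  have vi0 : v 0 i != 0 by apply: contraNneq v0 => vi0; rewrite Dv vi0 scale0r.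
  by rewrite -[delta_mx 0 i](scalerK vi0) -Dv memvZ.
have := Vx v vx; rewrite ev => /eqP; rewrite mulf_eq0 => /orP[]/eqP vi0.
  exists 1; apply: Dx; apply/rowP => -[[|[|//]] j]; rewrite !mxE /=.
    by rewrite mulr0 -[RHS]vi0; congr (v 0 _); apply: val_inj.
  by rewrite mulr1; congr (v 0 _); apply: val_inj.
exists 0; apply: Dx; apply/rowP => -[[|[|//]] j]; rewrite !mxE /=.
  by rewrite mulr1; congr (v 0 _); apply: val_inj.
by rewrite mulr0 -[RHS]vi0; congr (v 0 _); apply: val_inj.
Qed.

Lemma axis_inj : injective axis.
Proof.
move=> i j /(congr1 (@line k 2)) /= Dij.
have /vlineP[c /rowP/(_ i)] : delta_mx 0 i \in <[delta_mx 0%R j : 'rV[k]_2]>%VS.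
  by rewrite -Dij memv_line.
rewrite !mxE !eqxx /=; case: eqP => // _ /eqP.
by rewrite mulr0 oner_eq0.
Qed.

Lemma axes_not_grassmannian (W : vectType k) (M : fdmod (sqzero_ext W)) e :
  ~ variety_iso axes (pluecker_image (quiver_grassmannian M e)).
Proof.
move=> [phi [psi [_ _ phiK psiK]]].
have Ga i : axes (axis i) by apply/axesP; exists i.
have [[U0 G0 D0] phiK0] := phiK _ (Ga 0).
have [[U1 G1 D1] phiK1] := phiK _ (Ga 1).
have [sU0 _] := (quiver_grassmannian_dim _ G0).1 G0.
have [sU1 dU1] := (quiver_grassmannian_dim _ G0).1 G1.
have neU : U0 <> U1.
  move=> DU; have /projpt_eq eqphi : line (phi (axis 0)) = line (phi (axis 1)).
    by rewrite D0 D1 DU.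
  by have /axis_inj : axis 0 = axis 1 by rewrite -phiK0 eqphi phiK1.
(* The Pluecker point of [U] must come from one of the two axes, so injectivity of the embedding
   would make [U] equal to [U0] or [U1]. *)
have [U [sU dU neU0 neU1]] := third_submodule sU0 sU1 (esym dU1) neU.
have dL : \dim <[pluecker U]> = 1%N by rewrite dim_vline pluecker_neq0.
have GU : pluecker_image (quiver_grassmannian M e) (ProjPt dL).
  by exists U => //; apply/(quiver_grassmannian_dim _ G0).
have [/axesP[i Di] Dphi] := psiK _ GU.
have : line (phi (axis i)) = <[pluecker U]>%VS by rewrite -Di Dphi.
case: i {Di} => [[|[|//]]] i.
  rewrite (_ : Ordinal i = 0) ?D0; last exact: val_inj.
  by move/(pluecker_inj (esym dU))/esym.
rewrite (_ : Ordinal i = 1) ?D1; last exact: val_inj.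
by move/(pluecker_inj (etrans dU1 (esym dU)))/esym.
Qed.

End TwoPoints.

(** * Controlled wildness *)

Section Radical.

Variables (k : fieldType) (A : falgType k).
Implicit Types X Y Z : fdmod A.

Lemma modhom_eq X Y (f g : modhom X Y) : (forall x, f x = g x) -> f = g.
Proof. by move=> eqfg; apply/val_inj/lfunP. Qed.

Lemma modhom_compE X Y Z (g : modhom Y Z) (f : modhom X Y) x :
  modhom_comp g f x = g (f x).
Proof. exact: comp_lfunE. Qed.

Lemma modhom_idE X (x : X) : modhom_id X x = x.
Proof. exact: id_lfunE. Qed.

Lemma modhom_addE X Y (f g : modhom X Y) x : (f + g) x = f x + g x.
Proof. exact: add_lfunE. Qed.

Lemma modhom0E X Y x : (0 : modhom X Y) x = 0.
Proof. exact: zero_lfunE. Qed.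

Lemma zero_mod0 X (x : X) : zero_mod X -> x = 0.
Proof.
move/eqP; rewrite dimv_eq0 => /eqP X0; apply/eqP.
by rewrite -memv0 -X0 memvf.
Qed.

Lemma direct_sum_dim Z X Y :
  direct_sum Z X Y -> \dim {:Z} = (\dim {:X} + \dim {:Y})%N.
Proof.
move=> [i [j [p [q [pi qj pj qi ipjq]]]]].
have piE x : p (i x) = x by rewrite -modhom_compE pi modhom_idE.
have qjE y : q (j y) = y by rewrite -modhom_compE qj modhom_idE.
have pjE y : p (j y) = 0 by rewrite -modhom_compE pj modhom0E.
have DZ z : z = i (p z) + j (q z).
  by rewrite -!modhom_compE -modhom_addE ipjq modhom_idE.
have limgp : limg p = fullv.
  by apply/vspaceP => x; rewrite memvf -(piE x) memv_img ?memvf.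
have kerp : lker p = limg j.
  apply/vspaceP => z; rewrite memv_ker; apply/eqP/memv_imgP => [pz|[y _ ->]].
    by exists (q z); rewrite ?memvf // {1}(DZ z) pz linear0 add0r.
  exact: pjE.
rewrite -(limg_ker_dim p fullv) limgp capfv kerp limg_dim_eq 1?addnC //.
apply/eqP; rewrite -subv0 capfv; apply/subvP => y; rewrite memv_ker => /eqP jy.
by rewrite -(qjE y) jy linear0 mem0v.
Qed.

Lemma not_indecomposable X : ~ zero_mod X -> ~ indecomposable X ->
  exists Y Z, [/\ direct_sum X Y Z, (\dim {:Y} < \dim {:X})%N
                & (\dim {:Z} < \dim {:X})%N].
Proof.
move=> nz /not_andP[//|/existsNP[Y /existsNP[Z /not_implyP[DX]]]].
move=> /not_orP[Y0 Z0].
exists Y, Z; split=> //; rewrite (direct_sum_dim DX).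
  by rewrite -[X in (X < _)%N]addn0 ltn_add2l lt0n; apply/eqP.
by rewrite -[X in (X < _)%N]add0n ltn_add2r lt0n; apply/eqP.
Qed.

(* Decompose source and target into indecomposables. *)
Lemma rad_indecomposable X Y (f : modhom X Y) :
    (forall X' Y' (i : modhom X' X) (p : modhom Y Y'),
       indecomposable X' -> indecomposable Y' ->
       ~ invertible (modhom_comp p (modhom_comp f i))) ->
  Defs.rad f.
Proof.
have [n] := ubnP (\dim {:X} + \dim {:Y}).
elim: n X Y f => // n IHn X Y f; rewrite ltnS => led Hf.
have [X0|nzX] := pselect (zero_mod X).
  suff ->: f = 0 by apply: rad_zero.
  by apply: modhom_eq => x; rewrite (zero_mod0 x X0) linear0 modhom0E.
have [Y0|nzY] := pselect (zero_mod Y).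
  suff ->: f = 0 by apply: rad_zero.
  by apply: modhom_eq => x; rewrite modhom0E; apply: zero_mod0.
have [indX|/(not_indecomposable nzX)[X1 [X2 [DX d1 d2]]]] :=
    pselect (indecomposable X); last first.
  have [i [j [p [q [_ _ _ _ ipjq]]]]] := DX.
  have ->: f = modhom_comp (modhom_comp f i) p
                + modhom_comp (modhom_comp f j) q.
    apply: modhom_eq => x; rewrite modhom_addE !modhom_compE -linearD.
    by rewrite -!modhom_compE -modhom_addE ipjq modhom_idE.
  apply: rad_add; apply: rad_compr; apply: IHn => [|X' Y' i' p' iX' iY'].
  - by apply: leq_trans led; rewrite ltn_add2r.
  - suff -> : modhom_comp (modhom_comp f i) i' =
        modhom_comp f (modhom_comp i i').
      exact: Hf.
    by apply: modhom_eq => x; rewrite !modhom_compE.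
  - by apply: leq_trans led; rewrite ltn_add2r.
  - suff -> : modhom_comp (modhom_comp f j) i' =
        modhom_comp f (modhom_comp j i').
      exact: Hf.
    by apply: modhom_eq => x; rewrite !modhom_compE.
have [indY|/(not_indecomposable nzY)[Y1 [Y2 [DY d1 d2]]]] :=
    pselect (indecomposable Y); last first.
  have [i [j [p [q [_ _ _ _ ipjq]]]]] := DY.
  have ->: f = modhom_comp i (modhom_comp p f)
                + modhom_comp j (modhom_comp q f).
    apply: modhom_eq => x; rewrite modhom_addE !modhom_compE.
    rewrite -(modhom_compE i p) -(modhom_compE j q) -modhom_addE.
    by rewrite ipjq modhom_idE.
  apply: rad_add; apply: rad_compl; apply: IHn => [|X' Y' i' p' iX' iY'].
  - by apply: leq_trans led; rewrite ltn_add2l.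
  - suff -> : modhom_comp p' (modhom_comp (modhom_comp p f) i') =
        modhom_comp (modhom_comp p' p) (modhom_comp f i') by apply: Hf.
    by apply: modhom_eq => x; rewrite !modhom_compE.
  - by apply: leq_trans led; rewrite ltn_add2l.
  - suff -> : modhom_comp p' (modhom_comp (modhom_comp q f) i') =
        modhom_comp (modhom_comp p' q) (modhom_comp f i') by apply: Hf.
    by apply: modhom_eq => x; rewrite !modhom_compE.
apply: rad_gen => //; have := Hf _ _ (modhom_id X) (modhom_id Y) indX indY.
suff -> : modhom_comp (modhom_id Y) (modhom_comp f (modhom_id X)) = f by [].
by apply: modhom_eq => x; rewrite !modhom_compE !modhom_idE.
Qed.

End Radical.

(** * Kronecker representations as modules over the square-zero extension *)

Section KroneckerModules.

Variables (k : fieldType) (W : vectType k).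
Local Notation L := (sqzero_ext W).

Section Object.

Variables (Q : vectType k) (A : {linear W -> 'End(Q)}).

(** This is a representation of a generalized Kronecker quiver with the space [Q] at both vertices,
    the vertices being glued: the first copy is the top, the second the bottom. *)
Definition kron_act_fun (w : W) (p : (Q * Q)%type) : (Q * Q)%type :=
  (0, A w p.1).

Fact kron_act_fun_linear w : linear (kron_act_fun w).
Proof. by move=> c p q; congr (_, _); rewrite /= ?scaler0 ?addr0 ?linearP. Qed.
HB.instance Definition _ w :=
  GRing.isLinear.Build k _ _ _ (kron_act_fun w) (kron_act_fun_linear w).

Definition kron_act w : 'End((Q * Q)%type) := linfun (kron_act_fun w).

Lemma kron_actE w p : kron_act w p = (0, A w p.1).
Proof. exact: lfunE. Qed.

Fact kron_act_linear : linear kron_act.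
Proof.
move=> c v w; apply/lfunP => p.
rewrite add_lfunE scale_lfunE !kron_actE; congr (_, _) => /=.
  by rewrite scaler0 addr0.
by rewrite linearP add_lfunE scale_lfunE.
Qed.
HB.instance Definition _ :=
  GRing.isLinear.Build k _ _ _ kron_act kron_act_linear.

Fact kron_act2 v w p : kron_act v (kron_act w p) = 0.
Proof. by rewrite !kron_actE linear0. Qed.

Definition kron_mod : fdmod L := sqzero_mod kron_act2.

Lemma radact_kron w (s t : Q) :
  radact kron_mod w ((s, t) : (Q * Q)%type) = ((0, A w s) : (Q * Q)%type).
Proof. by rewrite radact_sqzero_mod; apply: kron_actE. Qed.

End Object.

Section Maps.

Variables Q Q' : vectType k.

Definition diag_map (a : 'Hom(Q, Q')) (p : (Q * Q)%type) : (Q' * Q')%type :=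
  (a p.1, a p.2).

Fact diag_map_linear a : linear (diag_map a).
Proof. by move=> c p q; rewrite /diag_map !linearP. Qed.
HB.instance Definition _ a :=
  GRing.isLinear.Build k _ _ _ (diag_map a) (diag_map_linear a).

Definition diag_lfun a : 'Hom((Q * Q)%type, (Q' * Q')%type) :=
  linfun (diag_map a).

Lemma diag_lfunE a s t : diag_lfun a (s, t) = (a s, a t).
Proof. exact: lfunE. Qed.

Variables (A : {linear W -> 'End(Q)}) (A' : {linear W -> 'End(Q')}).

Definition intertwines (a : 'Hom(Q, Q')) : Prop :=
  forall w q, a (A w q) = A' w (a q).

Fact kron_hom_subproof a : intertwines a ->
  diag_lfun a \in @modhom_pred k L (kron_mod A) (kron_mod A').
Proof.
move=> aA; apply: radact_modhom => w [s t].
by rewrite radact_kron !diag_lfunE radact_kron linear0 aA.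
Qed.

Definition kron_hom a (aA : intertwines a) :
    modhom (kron_mod A) (kron_mod A') :=
  ModHom (kron_hom_subproof aA).

Lemma kron_homE a (aA : intertwines a) (s t : Q) :
  kron_hom aA ((s, t) : (Q * Q)%type) = ((a s, a t) : (Q' * Q')%type).
Proof. exact: diag_lfunE. Qed.

Section Decomposition.

Variable h : modhom (kron_mod A) (kron_mod A').

Definition on_top (q : Q) : (Q' * Q')%type := h ((q, 0) : (Q * Q)%type).

Fact on_top_linear : linear on_top.
Proof.
move=> c p q; rewrite /on_top -linearP; congr (h _); congr (_, _).
by rewrite /= scaler0 addr0.
Qed.
HB.instance Definition _ := GRing.isLinear.Build k _ _ _ on_top on_top_linear.

Definition top_part : 'Hom(Q, Q') := linfun (fst \o on_top).

Lemma top_partE q : top_part q = (on_top q).1.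
Proof. by rewrite lfunE. Qed.

Definition top_to_bot_fun (q : Q) : (Q' * Q')%type := (0, (on_top q).2).

Fact top_to_bot_linear : linear top_to_bot_fun.
Proof.
move=> c p q; rewrite /top_to_bot_fun linearP.
by congr (_, _); rewrite /= scaler0 addr0.
Qed.
HB.instance Definition _ :=
  GRing.isLinear.Build k _ _ _ top_to_bot_fun top_to_bot_linear.

Variable e : W.
Hypotheses (Ae : A e = \1%VF) (A'e : A' e = \1%VF).

(** Since [e] carries the top identically to the bottom on both sides, the action of [h] on the top
    determines it on the bottom. *)
Lemma on_bot q : h ((0, q) : (Q * Q)%type) = ((0, top_part q) : (Q' * Q')%type).
Proof.
have -> : ((0, q) : (Q * Q)%type) =
    radact (kron_mod A) e ((q, 0) : (Q * Q)%type).
  by rewrite radact_kron Ae id_lfunE.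
rewrite modhom_radact (surjective_pairing (h _)) radact_kron A'e id_lfunE.
by rewrite top_partE.
Qed.

Lemma top_part_intertwines : intertwines top_part.
Proof.
move=> w q.
have := modhom_radact h w ((q, 0) : (Q * Q)%type).
rewrite radact_kron on_bot (surjective_pairing (h (q, 0))) radact_kron.
by rewrite [top_part q]top_partE => -[].
Qed.

Fact to_top_subproof :
  linfun (fst : (Q * Q)%type -> Q)
    \in @modhom_pred k L (kron_mod A) (trivial_mod W Q).
Proof.
apply: radact_modhom => w [s t].
by rewrite radact_kron radact_trivial lfunE.
Qed.

Fact top_to_bot_subproof :
  linfun top_to_bot_fun
    \in @modhom_pred k L (trivial_mod W Q) (kron_mod A').
Proof.
apply: radact_modhom => w q; rewrite radact_trivial linear0.
have -> : linfun top_to_bot_fun q = top_to_bot_fun q by rewrite lfunE.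
by rewrite radact_kron linear0.
Qed.

(** The only freedom left by [on_bot] is a linear map from top to bottom, and it factors through the
    trivial module on [Q]. *)
Lemma kron_hom_decomp :
  h = kron_hom top_part_intertwines
      + modhom_comp (ModHom top_to_bot_subproof) (ModHom to_top_subproof).
Proof.
apply: modhom_eq => -[s t]; rewrite modhom_addE modhom_compE kron_homE /=.
have -> : h ((s, t) : (Q * Q)%type) = on_top s + h ((0, t) : (Q * Q)%type).
  rewrite /on_top -linearD; congr (h _).
  by congr (_, _); rewrite /= ?addr0 ?add0r.
rewrite on_bot [linfun fst _]lfunE [linfun top_to_bot_fun _]lfunE.
rewrite (surjective_pairing (on_top s)) -top_partE.
by congr (_, _); rewrite /= addrC.
Qed.

End Decomposition.
End Maps.

(** These are the semisimple modules; they form the class [C] required by controlled wildness. *)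
Definition rad_annihilated (Z : fdmod L) : Prop :=
  forall w (z : Z), radact Z w z = 0.

Lemma add_closure_annihilated Z :
  add_closure rad_annihilated Z -> rad_annihilated Z.
Proof.
elim=> {Z} [//|Z Z0 w z|Z X Y [i [j [p [q [_ _ _ _ ipjq]]]]] _ HX _ HY w z|].
- exact: zero_mod0.
- rewrite -[z]modhom_idE -ipjq modhom_addE !modhom_compE linearD /=.
  by rewrite -(modhom_radact i) -(modhom_radact j) HX HY !linear0 addr0.
move=> Z X Y [i [j [p [q [pi _ _ _ _]]]]] _ HZ w x.
by rewrite -[x]modhom_idE -pi modhom_compE -modhom_radact HZ linear0.
Qed.

Variable e : W.

(** The bottom copy is the image of [e], hence consists of radical multiples. *)
Lemma kron_factor_bot (Q : vectType k) (Z : fdmod L)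
    (A : {linear W -> 'End(Q)}) (q : Q) (f : modhom (kron_mod A) Z) :
  A e = \1%VF -> rad_annihilated Z -> f ((0, q) : (Q * Q)%type) = 0.
Proof.
move=> Ae HZ.
have -> : ((0, q) : (Q * Q)%type) =
    radact (kron_mod A) e ((q, 0) : (Q * Q)%type).
  by rewrite radact_kron Ae id_lfunE.
by rewrite modhom_radact HZ.
Qed.

(* An indecomposable summand split off through an annihilated module would  *)
(* lie in the socle [0 x Q], which maps to zero.                            *)
Lemma kron_factor_rad (Q : vectType k) (A : {linear W -> 'End(Q)}) Y
    (h : modhom (kron_mod A) Y) :
  A e = \1%VF -> factors_through rad_annihilated h -> Defs.rad h.
Proof.
move=> Ae [Z [f [g [/add_closure_annihilated HZ ->]]]]; apply: rad_compl.
apply: rad_indecomposable => X' Y' i p [nzX' _] _ [u [upfi _]].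
case: nzX'; apply/eqP; rewrite dimv_eq0 -subv0; apply/subvP => x _.
rewrite memv0; apply/eqP.
rewrite -[x]modhom_idE -upfi !modhom_compE.
have : radact (kron_mod A) e (i x) = 0.
  rewrite -modhom_radact -[radact _ _ _]modhom_idE -upfi !modhom_compE.
  by rewrite (modhom_radact i) (modhom_radact f) HZ !linear0.
case: (i x) => s t; rewrite radact_kron Ae id_lfunE => -[->].
by rewrite kron_factor_bot // !linear0.
Qed.
End KroneckerModules.

(** * The functor from [G]-modules, and its properties *)

Section WildFunctor.

Variables (k : fieldType) (G : falgType k).
Local Notation N := (\dim {:G}).

(* The extra summand, on which [diag] is 0 because the basis is padded with  *)
(* [0] there, only makes the index type inhabited for free.                  *)
Section Operators.

Variable X : fdmod G.
Local Notation P := {ffun 'I_N.+1 -> X}.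

(** The index is a natural number, with value 0 beyond [N], so that [shift_delta] holds without a
    bound. *)
Definition delta (n : nat) (x : X) : P :=
  [ffun j : 'I_N.+1 => if j == n :> nat then x else 0].

Definition shift (w : P) : P :=
  [ffun j : 'I_N.+1 => if j == 0%N :> nat then 0 else w (inord j.-1)].
Definition head (w : P) : P :=
  [ffun j : 'I_N.+1 => if j == 0%N :> nat then w j else 0].
Definition diag (w : P) : P :=
  [ffun j : 'I_N.+1 => act X (vbasis {:G})`_j (w j)].

Fact shift_linear : linear shift.
Proof.
move=> c v w; apply/ffunP => j; rewrite !ffunE.
by case: ifP; rewrite ?scaler0 ?addr0 ?ffunE.
Qed.
HB.instance Definition _ := GRing.isLinear.Build k _ _ _ shift shift_linear.

Fact head_linear : linear head.
Proof.
move=> c v w; apply/ffunP => j; rewrite !ffunE.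
by case: ifP; rewrite ?scaler0 ?addr0 ?ffunE.
Qed.
HB.instance Definition _ := GRing.isLinear.Build k _ _ _ head head_linear.

Fact diag_linear : linear diag.
Proof. by move=> c v w; apply/ffunP => j; rewrite !ffunE linearP. Qed.
HB.instance Definition _ := GRing.isLinear.Build k _ _ _ diag diag_linear.

(** Index 3 is past the end of the list and yields the default, the identity. *)
Definition op (i : 'I_4) : 'End(P) :=
  nth \1%VF [:: linfun shift; linfun head; linfun diag] i.

Definition pencil (u : 'rV[k]_4) : 'End(P) := \sum_i u 0 i *: op i.

Fact pencil_linear : linear pencil.
Proof.
move=> c u v; rewrite /pencil scaler_sumr -big_split; apply: eq_bigr => i _.
by rewrite !mxE scalerDl scalerA.
Qed.
HB.instance Definition _ := GRing.isLinear.Build k _ _ _ pencil pencil_linear.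

Lemma pencil_delta i : pencil (delta_mx 0 i) = op i.
Proof.
rewrite /pencil (bigD1 i) //= mxE !eqxx scale1r big1 ?addr0 // => j ji.
by rewrite mxE (negPf ji) andbF scale0r.
Qed.

Lemma pencil_shift : pencil (delta_mx 0 0) = linfun shift.
Proof. exact: pencil_delta. Qed.
Lemma pencil_head : pencil (delta_mx 0 1) = linfun head.
Proof. exact: pencil_delta. Qed.
Lemma pencil_diag : pencil (delta_mx 0 2) = linfun diag.
Proof. exact: pencil_delta. Qed.
Lemma pencil_id : pencil (delta_mx 0 3) = \1%VF.
Proof. exact: pencil_delta. Qed.

Lemma shift_delta n x : shift (delta n x) = delta n.+1 x.
Proof.
apply/ffunP => j; rewrite !ffunE; case: j => [[|j] ltj] //=.
by rewrite inordK // ltnW.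
Qed.

Lemma head_delta x : head (delta 0 x) = delta 0 x.
Proof. by apply/ffunP => j; rewrite !ffunE; case: eqP. Qed.

Lemma diag_delta (i : 'I_N.+1) x :
  diag (delta i x) = delta i (act X (vbasis {:G})`_i x).
Proof.
apply/ffunP => j; rewrite !ffunE; case: eqP => [/val_inj->|] //.
by rewrite linear0.
Qed.

Lemma delta_sum (w : P) : w = \sum_(i < N.+1) delta i (w i).
Proof.
apply/ffunP => j; rewrite sum_ffunE (bigD1 j) //= ffunE eqxx big1 ?addr0 //.
by move=> i ij; rewrite ffunE eq_sym (inj_eq val_inj) (negPf ij).
Qed.

End Operators.

Section Morphisms.

Variables X Y : fdmod G.
Local Notation PX := {ffun 'I_N.+1 -> X}.
Local Notation PY := {ffun 'I_N.+1 -> Y}.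

Definition pointwise (f : 'Hom(X, Y)) (w : PX) : PY := [ffun j => f (w j)].

Fact pointwise_linear f : linear (pointwise f).
Proof. by move=> c v w; apply/ffunP => j; rewrite !ffunE linearP. Qed.
HB.instance Definition _ f :=
  GRing.isLinear.Build k _ _ _ (pointwise f) (pointwise_linear f).

Lemma pointwise_intertwines (f : modhom X Y) :
  intertwines (pencil X) (pencil Y) (linfun (pointwise f)).
Proof.
have fE w : linfun (pointwise f) w = pointwise f w by rewrite lfunE.
move=> u w; rewrite /pencil !sum_lfunE linear_sum; apply: eq_bigr => i _.
rewrite !scale_lfunE linearZ; congr (_ *: _).
rewrite /op; case: i => [[|[|[|[|//]]]] lti] /=; rewrite ?id_lfunE // !fE.
- rewrite [linfun _ w]lfunE [RHS]lfunE; apply/ffunP => j; rewrite !ffunE.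
  by case: ifP; rewrite ?linear0 ?ffunE.
- rewrite [linfun _ w]lfunE [RHS]lfunE; apply/ffunP => j; rewrite !ffunE.
  by case: ifP; rewrite ?linear0.
rewrite [linfun _ w]lfunE [RHS]lfunE; apply/ffunP => j; rewrite !ffunE.
by have /asboolP-> := modhomP f.
Qed.

(* [delta 0 x] lies in the image of [head] and [delta n x] is obtained from  *)
(* it by [n] shifts, so [a] acts as one and the same map on every summand.   *)
Lemma intertwines_pointwise (a : 'Hom(PX, PY)) :
    intertwines (pencil X) (pencil Y) a ->
  exists f : modhom X Y, a = linfun (pointwise f).
Proof.
move=> aP.
have a_shift w : a (shift w) = shift (a w).
  by have /= := aP (delta_mx 0 0) w; rewrite !pencil_shift !lfunE.
have a_head w : a (head w) = head (a w).
  by have /= := aP (delta_mx 0 1) w; rewrite !pencil_head !lfunE.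
have a_diag w : a (diag w) = diag (a w).
  by have /= := aP (delta_mx 0 2) w; rewrite !pencil_diag !lfunE.
pose f_fun x := a (delta 0 x) ord0.
have delta_linear n : linear (@delta X n).
  move=> c x y; apply/ffunP => j; rewrite !ffunE.
  by case: ifP; rewrite ?scaler0 ?addr0.
have f_lin : linear f_fun.
  by move=> c x y; rewrite /f_fun delta_linear linearP !ffunE.
pose fL := GRing.isLinear.Build k _ _ _ f_fun f_lin.
pose f : {linear X -> Y} := HB.pack f_fun fL.
have a_delta n x : a (delta n x) = delta n (f x).
  elim: n => [|n IHn]; last by rewrite -!shift_delta a_shift IHn.
  rewrite -head_delta a_head; apply/ffunP => j; rewrite !ffunE.
  by case: eqP => // j0; congr (a _ _); apply: val_inj.
have fP : linfun f \in @modhom_pred k G X Y.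
  apply/asboolP => c x; rewrite !lfunE.
  (* Comparing the summands number [i] of [a (diag (delta i x))] and [diag (a (delta i x))] gives
     compatibility with one basis vector of [G]; linearity gives the rest. *)
  have fg (i : 'I_N.+1) :
      f (act X (vbasis {:G})`_i x) = act Y (vbasis {:G})`_i (f x).
    have := a_diag (delta i x); rewrite diag_delta !a_delta diag_delta.
    by move/ffunP/(_ i); rewrite !ffunE eqxx.
  rewrite (coord_vbasis (memvf c)) !linear_sum !sum_lfunE linear_sum.
  apply: eq_bigr => i _; rewrite !linearZ !scale_lfunE linearZ; congr (_ *: _).
  exact: fg (widen_ord (leqnSn _) i).
exists (ModHom fP); apply/lfunP => w; rewrite lfunE.
rewrite [w in LHS]delta_sum linear_sum; apply/ffunP => j.
rewrite sum_ffunE (bigD1 j) //= a_delta !ffunE eqxx [RHS](lfunE f).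
rewrite big1 ?addr0 // => i ij.
by rewrite a_delta ffunE eq_sym (inj_eq val_inj) (negPf ij).
Qed.

End Morphisms.

Definition wild_obj (X : fdmod G) : fdmod (sqzero_ext 'rV[k]_4) :=
  kron_mod (pencil X).

Definition wild_map (X Y : fdmod G) (f : modhom X Y) :
    modhom (wild_obj X) (wild_obj Y) :=
  kron_hom (pointwise_intertwines f).

Lemma wild_mapE X Y (f : modhom X Y) (s t : {ffun 'I_N.+1 -> X}) :
  wild_map f ((s, t) : (_ * _)%type)
  = ((pointwise f s, pointwise f t) : (_ * _)%type).
Proof. by rewrite kron_homE !lfunE. Qed.

Fact wild_map_linear X Y : linear (@wild_map X Y).
Proof.
move=> c f g; apply: modhom_eq => -[s t].
rewrite modhom_addE.
have -> : (c *: wild_map f) ((s, t) : (_ * _)%type) = c *: wild_map f (s, t).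
  exact: scale_lfunE.
rewrite !wild_mapE; congr (_, _); apply/ffunP => j; rewrite !ffunE.
  by rewrite add_lfunE scale_lfunE.
by rewrite add_lfunE scale_lfunE.
Qed.
HB.instance Definition _ X Y :=
  GRing.isLinear.Build k _ _ _ (@wild_map X Y) (@wild_map_linear X Y).

Fact wild_map_id X : wild_map (modhom_id X) = modhom_id (wild_obj X).
Proof.
apply: modhom_eq => -[s t]; rewrite wild_mapE modhom_idE.
by congr (_, _); apply/ffunP => j; rewrite ffunE id_lfunE.
Qed.

Fact wild_map_comp X Y Z (g : modhom Y Z) (f : modhom X Y) :
  wild_map (modhom_comp g f) = modhom_comp (wild_map g) (wild_map f).
Proof.
apply: modhom_eq => -[s t]; rewrite modhom_compE !wild_mapE.
by congr (_, _); apply/ffunP => j; rewrite !ffunE comp_lfunE.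
Qed.

Definition wild_functor : functor G (sqzero_ext 'rV[k]_4) :=
  Functor wild_map_id wild_map_comp.

(** Exactness holds summand by summand. Preimages are taken with the linear one-sided inverses
    [f^-1] and [g^-1], to which [pointwise] applies although they need not be module maps. *)
Lemma wild_functor_exact : exact_functor wild_functor.
Proof.
move=> X Y Z f g [kf ig lg].
have f_inj : injective f by apply/lker0P; rewrite kf.
split.
- apply/eqP/lker0P => -[s t] [s' t'] /=; rewrite !wild_mapE => -[Ds Dt].
  congr (_, _); apply/ffunP => j; apply: f_inj.
    by move/ffunP/(_ j): Ds; rewrite !ffunE.
  by move/ffunP/(_ j): Dt; rewrite !ffunE.
- apply/vspaceP => -[s t]; rewrite memv_ker.
  apply/memv_imgP/eqP => [[[s' t'] _ ->]|] /=; rewrite !wild_mapE.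
    congr (_, _); apply/ffunP => j; rewrite !ffunE; apply/eqP;
    by rewrite -memv_ker -ig memv_img ?memvf.
  move=> [Ds Dt].
  have pre (w : {ffun 'I_N.+1 -> Y}) : pointwise g w = 0 ->
      w = pointwise f (pointwise (f^-1)%VF w).
    move=> Dw; apply/ffunP => j; rewrite !ffunE limg_lfunVK // ig memv_ker.
    by move/ffunP/(_ j): Dw; rewrite !ffunE => ->.
  exists ((pointwise (f^-1)%VF s, pointwise (f^-1)%VF t) : (_ * _)%type).
    by rewrite memvf.
  by rewrite wild_mapE -!pre.
apply/vspaceP => -[s t]; rewrite memvf; apply/memv_imgP.
exists ((pointwise (g^-1)%VF s, pointwise (g^-1)%VF t) : (_ * _)%type).
  by rewrite memvf.
rewrite wild_mapE; congr (_, _); apply/ffunP => j; rewrite !ffunE;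
by rewrite limg_lfunVK // lg memvf.
Qed.

Lemma wild_functor_faithful : faithful_functor wild_functor.
Proof.
move=> X Y f g /= eqfg; apply: modhom_eq => x.
have : wild_map f ((delta 0 x, 0) : (_ * _)%type) = wild_map g (delta 0 x, 0).
  by rewrite eqfg.
rewrite !wild_mapE => -[/ffunP/(_ ord0)] + _.
by rewrite !ffunE.
Qed.

End WildFunctor.

Lemma sqzero_ext_controlled_wild (k : fieldType) :
  controlled_wild (sqzero_ext 'rV[k]_4).
Proof.
move=> G; exists (wild_functor G), (@rad_annihilated k 'rV[k]_4).
split=> [||X Y]; first exact: wild_functor_exact.
  exact: wild_functor_faithful.
split=> [h|h|f].
- exact: kron_factor_rad (pencil_id X).
- have [f Df] := intertwines_pointwise
    (top_part_intertwines h (pencil_id X) (pencil_id Y)).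
  exists f; eexists; split; last first.
    rewrite {1}(kron_hom_decomp h (pencil_id X) (pencil_id Y)); congr (_ + _).
    by apply: modhom_eq => -[s t]; rewrite wild_mapE kron_homE Df !lfunE.
  (* The intermediate module is the trivial one on the top copy of [P], as found in
     [kron_hom_decomp]. *)
  do 3!eexists; split; last by [].
  by apply: add_in => w z; rewrite radact_trivial.
move=> [Z [f1 [g1 [/add_closure_annihilated HZ Df]]]].
apply: modhom_eq => -[s t]; rewrite modhom0E.
(* A map through a semisimple module vanishes on the bottom copy, where the image of [f] under the
   functor acts by the same block as on the top. *)
have f0 (q : {ffun 'I_(\dim {:G}).+1 -> X}) : pointwise f q = 0.
  have : wild_map f ((0, q) : (_ * _)%type) = 0.
    rewrite [wild_map f]Df modhom_compE (kron_factor_bot _ _ (pencil_id X)) //.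
    by rewrite linear0.
  by rewrite wild_mapE => -[].
by rewrite [LHS]wild_mapE !f0.
Qed.

Theorem proposition2 (k : closedFieldType) :
  exists L : falgType k,
    controlled_wild L /\
    exists (n : nat) (V : projpt k n.+1 -> Prop),
      zclosed V /\
      forall (M : fdmod L) (e : dimvec L),
        ~ variety_iso V (pluecker_image (quiver_grassmannian M e)).
Proof.
(* The radical has one dimension for each of the four operators in [op]. *)
exists (sqzero_ext 'rV[k]_4); split; first exact: sqzero_ext_controlled_wild.
exists 1%N, (@axes k); split; first exact: zclosed_axes.
exact: axes_not_grassmannian.
Qed.
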